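(* For any fixed $\bar P_0\in\mathcal{W}(\mathcal{X},\mathcal{D})$, the set $\mathcal{W}_\kappa(\mathcal{Y},\mathcal{E})$ is the disjoint union $$\mathcal{W}_\kappa(\mathcal{Y},\mathcal{E})=\biguplus_{P\in\mathcal{L}(\bar P_0)}\mathcal{J}(P),$$ and, as a manifold, $$\dim\mathcal{W}_\kappa(\mathcal{Y},\mathcal{E})=|\mathcal{E}|-\sum_{(x,x')\in\mathcal{D}}|\mathcal{S}_x|+|\mathcal{D}|-|\mathcal{X}|.$$
   Context: All vertex sets are finite with at least two elements. $(\mathcal{Y},\mathcal{E})$ is a strongly connected digraph and $\kappa\colon\mathcal{Y}\to\mathcal{X}$ is a surjective map (lumping function); $\mathcal{S}_x=\kappa^{-1}(\{x\})$, $\mathcal{D}=\{(\kappa(y),\kappa(y')):(y,y')\in\mathcal{E}\}$; it is assumed that $\mathcal{W}_\kappa(\mathcal{Y},\mathcal{E})\ne\emptyset$. $\mathcal{W}(\mathcal{Y},\mathcal{E})$ is the set of row-stochastic matrices on $\mathcal{Y}$ that are strictly positive on $\mathcal{E}$ and zero outside $\mathcal{E}$ (similarly for $(\mathcal{X},\mathcal{D})$), regarded as a smooth manifold. $P\in\mathcal{W}(\mathcal{Y},\mathcal{E})$ is $\kappa$-lumpable if $\sum_{y'\in\mathcal{S}_{x'}}P(y_1,y')=\sum_{y'\in\mathcal{S}_{x'}}P(y_2,y')$ for all $x,x'\in\mathcal{X}$, $y_1,y_2\in\mathcal{S}_x$; the common value is $\kappa_\star P(x,x')$, and $\kappa_\star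 P\in\mathcal{W}(\mathcal{X},\mathcal{D})$. $\mathcal{W}_\kappa(\mathcal{Y},\mathcal{E})$ is the set of $\kappa$-lumpable elements, regarded as a submanifold of $\mathcal{W}(\mathcal{Y},\mathcal{E})$. For $P_\odot\in\mathcal{W}_\kappa(\mathcal{Y},\mathcal{E})$, the canonical embedding is $\Lambda^{(P_\odot)}_\star\bar P(y,y')=\bar P(\kappa(y),\kappa(y'))\,\frac{P_\odot(y,y')}{\kappa_\star P_\odot(\kappa(y),\kappa(y'))}$ for $(y,y')\in\mathcal{E}$, and $0$ otherwise. Define $\mathcal{L}(\bar P_0)=\{P\in\mathcal{W}_\kappa(\mathcal{Y},\mathcal{E}):\kappa_\star P=\bar P_0\}$ and $\mathcal{J}(P_\odot)=\{\Lambda^{(P_\odot)}_\star\bar P:\bar P\in\mathcal{W}(\mathcal{X},\mathcal{D})\}$. The symbol $\biguplus$ denotes a union of pairwise disjoint sets ($\mathcal{J}(P)\cap\mathcal{J}(P')=\emptyset$ for distinct $P,P'\in\mathcal{L}(\bar P_0)$). *)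

(* Defs.v *)
From HB Require Import structures.
From mathcomp Require Import all_boot all_order all_algebra.
From mathcomp Require Import all_classical all_reals all_analysis.
Set Implicit Arguments.
Unset Strict Implicit.
Unset Printing Implicit Defensive.
Import Order.TTheory GRing.Theory Num.Theory.
Import numFieldNormedType.Exports.
Local Open Scope classical_set_scope.
Local Open Scope ring_scope.

(* [U] is meant to be open.  In finite dimension, a map is C^(k+1) on [U] iff it
   is differentiable there and all its directional derivatives are C^k. *)
Fixpoint Ck_on (R : realType) (m n k : nat) (U : set 'rV[R]_m)
    (f : 'rV[R]_m -> 'rV[R]_n) : Prop :=
  match k with
  | 0 => forall x, U x -> {for x, continuous f}
  | k'.+1 => (forall x, U x -> differentiable f x) /\
             (forall v, Ck_on k' U ('D_v f))
  end.

Definition smooth_on (R : realType) (m n : nat) (U : set 'rV[R]_m)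
    (f : 'rV[R]_m -> 'rV[R]_n) : Prop :=
  forall k, Ck_on k U f.

Definition diffeomorphism (R : realType) (m n : nat) (U : set 'rV[R]_m)
    (O : set 'rV[R]_n) (f : 'rV[R]_m -> 'rV[R]_n) (g : 'rV[R]_n -> 'rV[R]_m) : Prop :=
  [/\ open U /\ open O,
      f @` U = O /\ g @` O = U,
      forall x, U x -> g (f x) = x,
      forall z, O z -> f (g z) = z
    & smooth_on U f /\ smooth_on O g].

Definition slice (R : realType) (N d : nat) : set 'rV[R]_N :=
  [set z : 'rV[R]_N | forall i : 'I_N, (d <= i)%N -> z 0 i = 0].

(* Embedded smooth submanifold of R^N of dimension [d], by slice charts.  Without
   [d <= N] the slice condition would be void and any open set would have every
   dimension [d >= N]. *)
Definition submanifold_dim (R : realType) (N : nat) (S : set 'rV[R]_N) (d : nat) : Prop :=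
  (d <= N)%N /\
  forall p, S p ->
    exists U O : set 'rV[R]_N, exists f g : 'rV[R]_N -> 'rV[R]_N,
      [/\ U p, diffeomorphism U O f g & f @` (S `&` U) = O `&` @slice R N d].

(* A matrix indexed by a finite set [T] is a finite function on [T * T];
   [coords] identifies the space of such matrices with R^(|T|^2). *)
Definition coords (R : realType) (T : finType) (P : {ffun T * T -> R}) :
    'rV[R]_#|{: T * T}| :=
  \row_k P (enum_val k).

Definition strongly_connected (T : finType) (E : {set T * T}) : Prop :=
  forall y y' : T, connect (fun a b => (a, b) \in E) y y'.

Definition row_stochastic (R : realType) (T : finType) (P : {ffun T * T -> R}) : Prop :=
  (forall e, 0 <= P e) /\ (forall y, \sum_(y' : T) P (y, y') = 1).

Definition W (R : realType) (T : finType) (E : {set T * T}) : set {ffun T * T -> R} :=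
  [set P | [/\ row_stochastic P,
               forall e, e \in E -> 0 < P e
             & forall e, e \notin E -> P e = 0]].

Definition fiber (X Y : finType) (kappa : Y -> X) (x : X) : {set Y} :=
  [set y | kappa y == x].

Definition lumped_edges (X Y : finType) (kappa : Y -> X) (E : {set Y * Y}) :
    {set X * X} :=
  [set (kappa e.1, kappa e.2) | e in E].

Definition lumpable (R : realType) (X Y : finType) (kappa : Y -> X)
    (P : {ffun Y * Y -> R}) : Prop :=
  forall (x x' : X) (y1 y2 : Y), y1 \in fiber kappa x -> y2 \in fiber kappa x ->
    \sum_(y' in fiber kappa x') P (y1, y') = \sum_(y' in fiber kappa x') P (y2, y').

Definition W_kappa (R : realType) (X Y : finType) (kappa : Y -> X) (E : {set Y * Y}) :
    set {ffun Y * Y -> R} :=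
  [set P | W E P /\ lumpable kappa P].

(* The row sum is read off at an arbitrary representative of the fiber of [x]; for
   lumpable [P] it does not depend on the choice.  The value 0 is never used when
   [kappa] is surjective. *)
Definition lump (R : realType) (X Y : finType) (kappa : Y -> X)
    (P : {ffun Y * Y -> R}) : {ffun X * X -> R} :=
  [ffun e : X * X =>
    if [pick y in fiber kappa e.1] is Some y
    then \sum_(y' in fiber kappa e.2) P (y, y') else 0%R : R].

Definition canonical_embedding (R : realType) (X Y : finType) (kappa : Y -> X)
    (E : {set Y * Y}) (Po : {ffun Y * Y -> R}) (Pbar : {ffun X * X -> R}) :
    {ffun Y * Y -> R} :=
  [ffun e : Y * Y =>
    if e \in E
    then Pbar (kappa e.1, kappa e.2) * (Po e / lump kappa Po (kappa e.1, kappa e.2))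
    else 0].

Definition leaf_L (R : realType) (X Y : finType) (kappa : Y -> X) (E : {set Y * Y})
    (P0 : {ffun X * X -> R}) : set {ffun Y * Y -> R} :=
  [set P | W_kappa kappa E P /\ lump kappa P = P0].

Definition leaf_J (R : realType) (X Y : finType) (kappa : Y -> X) (E : {set Y * Y})
    (Po : {ffun Y * Y -> R}) : set {ffun Y * Y -> R} :=
  [set canonical_embedding kappa E Po Pbar | Pbar in W (lumped_edges kappa E)].

(* Main.v *)
Require Import Defs.
From mathcomp Require Import all_boot all_order all_algebra.
From mathcomp Require Import all_classical all_reals all_analysis.
From mathcomp Require Import ring.
Set Implicit Arguments.
Unset Strict Implicit.
Unset Printing Implicit Defensive.
Import Order.TTheory GRing.Theory Num.Theory.
Import numFieldNormedType.Exports.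
Local Open Scope classical_set_scope.
Local Open Scope ring_scope.

(* W_kappa is an open piece of an affine space: on the matrices vanishing off E,
   lumpability and stochasticity are affine, and positivity on E is open.  A
   direction of this affine space is determined, freely, by its entries on the
   edges that remain after discarding, for each y and each block x' with
   (kappa y, x') in D, one pivot edge from y into the block: that entry is fixed
   by the block sum, which must agree with that of a chosen representative of the
   fiber of y; in the representative's own row only one pivot is discarded, for
   the total row sum.  This leaves |E| - (sum_D |S_x| - |D| + |X|) coordinates.
   The union holds because the canonical embedding can be undone by swapping roles:
   the canonical embedding of kappa_* Q along P, where P is that of P0 along Q, is
   Q. *)

(** * Affine maps and open pieces of affine spaces *)

Lemma mulmxr_continuous (R : realType) (m n : nat) (A : 'M[R]_(m, n)) :
  continuous (fun u : 'rV[R]_m => u *m A).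
Proof.
move=> u; apply: differentiable_continuous.
have -> : (fun u : 'rV[R]_m => u *m A) =
    \sum_(i < m) (fun u : 'rV[R]_m => u 0 i *: row i A).
  by apply/funext => v; rewrite mulmx_sum_row fct_sumE.
apply: differentiable_sum => i; apply: differentiableZl.
exact: differentiable_coord.
Qed.

(** A directional derivative of an affine map is constant, hence affine with matrix 0; the induction
    on [k] therefore ranges over all [A] and [c]. *)
Lemma affine_smooth (R : realType) (m n : nat) (U : set 'rV[R]_m)
    (A : 'M[R]_(m, n)) (c : 'rV[R]_n) :
  smooth_on U (fun u => u *m A + c).
Proof.
have cont (B : 'M[R]_(m, n)) : continuous (mulmxr B : {linear 'rV[R]_m -> _}).
  exact: mulmxr_continuous.
have dlin (B : 'M[R]_(m, n)) x :
    differentiable (mulmxr B : {linear 'rV[R]_m -> _}) x.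
  exact: linear_differentiable.
have dA (B : 'M[R]_(m, n)) (b : 'rV[R]_n) x :
    differentiable (fun u : 'rV[R]_m => u *m B + b) x.
  exact: (differentiableD (dlin B x) (differentiable_cst b x)).
move=> k; elim: k A c => [|k IH] A c /=.
  by move=> x _; apply: differentiable_continuous; exact: dA.
split=> [x _|v]; first exact: dA.
suff -> : 'D_v (fun u => u *m A + c) = (fun u => u *m 0 + v *m A) by exact: IH.
apply/funext => x; rewrite mulmx0 add0r deriveE; last exact: dA.
have dfA : is_diff x (mulmxr A : {linear 'rV[R]_m -> 'rV[R]_n}) (mulmxr A).
  by apply: DiffDef => //; apply: diff_lin.
have [_ dE] := is_diffD dfA (is_diff_cst c x).
exact: etrans (congr1 (fun h => h v) dE) (addr0 _).
Qed.

Lemma sub_pid_mx (R : realType) (d N : nat) (z : 'rV[R]_N) :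
  (z <= (pid_mx d : 'M[R]_(d, N)))%MS <->
  slice d z.
Proof.
split=> [/submxP[w ->] i di|sz].
  rewrite mxE big1 // => k _; rewrite mxE.
  case: eqP => [ki|_]; last by rewrite mulr0.
  by move: (ltn_ord k); rewrite ki ltnNge di.
apply/submxP; exists (z *m (pid_mx d : 'M[R]_(N, d))).
rewrite -mulmxA mul_pid_mx minnn minnn.
apply/rowP => i; rewrite mxE (bigD1 i) //= mxE eqxx /= big1 => [|k ki].
  by have [id|/sz ->] := ltnP i d; rewrite ?mulr1 ?mul0r addr0.
by rewrite mxE (negbTE (ki : (k : nat) != i)) mulr0.
Qed.

(** One chart serves every point. Factor [M] as an invertible matrix, [pid_mx d] and [H]: the
    invertible left factor does not change the row space, so [z *m H + p0] carries the slice onto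
    the affine space. *)
Lemma affine_submanifold (R : realType) (N d : nat) (M : 'M[R]_(d, N))
    (p0 : 'rV[R]_N) (U S : set 'rV[R]_N) :
  open U -> row_free M ->
  (forall u, S u <-> U u /\ (u - p0 <= M)%MS) ->
  submanifold_dim S d.
Proof.
move=> oU Mfree SE; have rkM : \rank M = d by apply/eqP.
split; first by rewrite -rkM rank_leq_col.
pose H := row_ebase M; pose G := invmx H.
have Hu : H \in unitmx by exact: row_ebase_unit.
pose f (u : 'rV[R]_N) := u *m G + - (p0 *m G).
pose g (z : 'rV[R]_N) := z *m H + p0.
have fE u : f u = (u - p0) *m G by rewrite mulmxBl.
have fK u : g (f u) = u by rewrite /g fE mulmxKV // subrK.
have gK z : f (g z) = z by rewrite fE /g addrK mulmxK.
have sliceE z : slice d z <-> (z *m H <= M)%MS.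
  have := mulmx_ebase M; rewrite rkM -/H => MH.
  rewrite -sub_pid_mx -MH.
  rewrite submxMfree ?row_free_unit //.
  by rewrite (eqmxMfull _ (_ : row_full _)) // row_full_unit col_ebase_unit.
have gcont : continuous g.
  by move=> z; exact: (affine_smooth setT H p0 0%N).
move=> p Sp; exists U, [set z | U (g z)], f, g.
split; first by have /SE[] := Sp.
- split.
  + by split=> //; apply: open_comp => // z _; exact: gcont.
  + split; apply/seteqP; split=> z /=.
    * by move=> [u Uu <-]; rewrite fK.
    * by move=> Uz; exists (g z).
    * by move=> [u Uu <-].
    * by move=> Uz; exists (f z); rewrite ?fK.
  + by move=> x _; exact: fK.
  + by move=> z _; exact: gK.
  + by split; exact: affine_smooth.
- apply/seteqP; split=> z /=.
    move=> [u [/SE[Uu uM] _] <-]; rewrite fK; split=> //.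
    by apply/sliceE; rewrite fE mulmxKV.
  move=> [Uz /sliceE zM]; exists (g z); last exact: gK.
  by split=> //; apply/SE; split=> //; rewrite /g addrK.
Qed.

Lemma open_positive_entries (R : realType) (T : finType) (E : {set T}) :
  open [set u : 'rV[R]_#|T| | forall e, e \in E -> 0 < u 0 (enum_rank e)].
Proof.
rewrite openE => u Uu.
apply: (filter_forall (f := fun e => [set v : 'rV[R]_#|T| |
  e \in E -> 0 < v 0 (enum_rank e)]) (F := nbhs u)) => e.
have [eE|eE] := boolP (e \in E); last by apply: nearW => v /=.
have /open_nbhs_nbhs : open_nbhs u [set v : 'rV[R]_#|T| | 0 < v 0 (enum_rank e)].
  split; last exact: Uu.
  apply: (open_comp (f := fun v : 'rV[R]_#|T| => v 0 (enum_rank e))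
    (D := [set x : R | 0 < x])); last exact: open_gt.
  by move=> v _; exact: coord_continuous.
by apply: filterS => v ve _.
Qed.

(** * Block sums, lumping and the canonical embedding *)

Lemma lumpable_rowE (R : realType) (X Y : finType) (kappa : Y -> X)
    (P : {ffun Y * Y -> R}) :
  lumpable kappa P <-> forall y1 y2 x', kappa y1 = kappa y2 ->
    \sum_(y' in fiber kappa x') P (y1, y') = \sum_(y' in fiber kappa x') P (y2, y').
Proof.
split=> [Pl y1 y2 x' k12|Pl x x' y1 y2].
  by apply: (Pl (kappa y1)); rewrite inE // k12.
by rewrite !inE => /eqP k1 /eqP k2; apply: Pl; rewrite k1.
Qed.

Lemma sum_fibers (R : realType) (X Y : finType) (kappa : Y -> X) (f : Y -> R) :
  \sum_y f y = \sum_x \sum_(y in fiber kappa x) f y.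
Proof.
rewrite (partition_big kappa predT) //=; apply: eq_bigr => x _.
by apply: eq_bigl => y; rewrite inE.
Qed.

Lemma lumped_edge (X Y : finType) (kappa : Y -> X) (E : {set Y * Y}) (e : Y * Y) :
  e \in E -> (kappa e.1, kappa e.2) \in lumped_edges kappa E.
Proof. by move=> eE; apply/imsetP; exists e. Qed.

Lemma W_block_gt0 (R : realType) (X Y : finType) (kappa : Y -> X)
    (E : {set Y * Y}) (P : {ffun Y * Y -> R}) (y y' : Y) :
  W E P -> (y, y') \in E -> 0 < \sum_(z in fiber kappa (kappa y')) P (y, z).
Proof.
move=> [[P0 _] Ppos _] yE; rewrite (bigD1 y') ?inE //=.
by rewrite ltr_pwDl ?Ppos // sumr_ge0.
Qed.

Section Lumping.
Variables (R : realType) (X Y : finType) (kappa : Y -> X) (E : {set Y * Y}).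
Hypothesis kappa_surj : forall x : X, exists y : Y, kappa y = x.
Local Notation D := (lumped_edges kappa E).
Implicit Types (P Q : {ffun Y * Y -> R}) (Pbar : {ffun X * X -> R}).

Lemma embeddingE P Pbar e : e \in E ->
  canonical_embedding kappa E P Pbar e =
  Pbar (kappa e.1, kappa e.2) * (P e / lump kappa P (kappa e.1, kappa e.2)).
Proof. by move=> eE; rewrite [LHS]ffunE eE. Qed.

Lemma lumpE P y x' : lumpable kappa P ->
  lump kappa P (kappa y, x') = \sum_(y' in fiber kappa x') P (y, y').
Proof.
move=> /lumpable_rowE Pl; rewrite ffunE /=; case: pickP => [y1|/(_ y)].
  by rewrite inE => /eqP; exact: Pl.
by rewrite inE eqxx.
Qed.

Lemma lump_gt0 P e : W_kappa kappa E P -> e \in D -> 0 < lump kappa P e.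
Proof.
move=> [PW Pl] /imsetP[[y y'] yE ->] /=.
by rewrite lumpE // (W_block_gt0 kappa (E := E)).
Qed.

Lemma lump_eq0 P e : W_kappa kappa E P -> e \notin D -> lump kappa P e = 0.
Proof.
case: e => x x' [[_ _ P0] Pl] xD; have [y yx] := kappa_surj x.
rewrite -yx lumpE // big1 // => y'; rewrite inE => /eqP yx'; apply: P0.
by apply: contra xD => /(lumped_edge kappa) /=; rewrite yx yx'.
Qed.

Lemma lump_W P : W_kappa kappa E P -> W D (lump kappa P).
Proof.
move=> PW; have [[[P0 P1] _ _] Pl] := PW.
split; [split=> [e|x]|by move=> e; exact: lump_gt0|by move=> e; exact: lump_eq0].
  by have [/(lump_gt0 PW)/ltW|/(lump_eq0 PW)->] := boolP (e \in D).
have [y <-] := kappa_surj x; rewrite -[RHS](P1 y) (sum_fibers kappa).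
by apply: eq_bigr => x' _; rewrite lumpE.
Qed.

(** Along a block the embedding scales [P] by a constant whose denominator, the lumped value, is the
    block sum of [P]. *)
Lemma sum_fiber_embedding P Pbar y x' : W_kappa kappa E P -> W D Pbar ->
  \sum_(y' in fiber kappa x') canonical_embedding kappa E P Pbar (y, y') =
  Pbar (kappa y, x').
Proof.
move=> PW [_ _ Pb0]; have [[_ _ P0] Pl] := PW.
transitivity (\sum_(y' in fiber kappa x')
    Pbar (kappa y, x') / lump kappa P (kappa y, x') * P (y, y')).
  apply: eq_bigr => y'; rewrite inE ffunE => /eqP /= ->.
  by case: ifPn => [_|/P0->]; rewrite ?mulr0 // mulrA mulrAC.
rewrite -mulr_sumr -lumpE //.
(* Outside [D] the denominator is 0, but [Pbar] vanishes there and both sides are 0. *)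
have [/(lump_gt0 PW)/lt0r_neq0 l0|/Pb0->] := boolP ((kappa y, x') \in D).
  by rewrite mulfVK.
by rewrite !mul0r.
Qed.

Lemma embedding_W_kappa P Pbar : W_kappa kappa E P -> W D Pbar ->
  W_kappa kappa E (canonical_embedding kappa E P Pbar).
Proof.
move=> PW PbW; have [[_ Ppos _] _] := PW; have [[_ Pb1] Pbpos _] := PbW.
have epos e : e \in E -> 0 < canonical_embedding kappa E P Pbar e.
  move=> eE; rewrite ffunE eE mulr_gt0 ?divr_gt0 ?Ppos //.
    by apply/Pbpos/lumped_edge.
  by apply/(lump_gt0 PW)/lumped_edge.
have e0 e : e \notin E -> canonical_embedding kappa E P Pbar e = 0.
  by move=> /negbTE eE; rewrite ffunE; move: (eE) => ->.
split.
  split=> //; split=> [e|y].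
    by have [/epos/ltW|/e0->] := boolP (e \in E).
  rewrite (sum_fibers kappa) -[RHS](Pb1 (kappa y)).
  by apply: eq_bigr => x' _; rewrite sum_fiber_embedding.
by apply/lumpable_rowE => y1 y2 x' k12; rewrite !sum_fiber_embedding // k12.
Qed.

Lemma lump_embedding P Pbar : W_kappa kappa E P -> W D Pbar ->
  lump kappa (canonical_embedding kappa E P Pbar) = Pbar.
Proof.
move=> PW PbW; apply/ffunP => -[x x']; have [y <-] := kappa_surj x.
by rewrite lumpE ?sum_fiber_embedding //; have [] := embedding_W_kappa PW PbW.
Qed.

Lemma embedding_swap P Pbar : W_kappa kappa E P -> W D Pbar ->
  canonical_embedding kappa E (canonical_embedding kappa E P Pbar) (lump kappa P) = P.
Proof.
move=> PW PbW; apply/ffunP => e; rewrite ffunE lump_embedding //.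
have [[_ _ P0] _] := PW; have [_ Pbpos _] := PbW.
case: ifPn => [eE|/P0->//]; rewrite [X in _ * (X / _)]embeddingE //.
have /lt0r_neq0 Pb0 := Pbpos _ (lumped_edge kappa eE).
have /lt0r_neq0 l0 := lump_gt0 PW (lumped_edge kappa eE).
by rewrite [X in _ * (X / _)]mulrC mulfK // mulrC divfK.
Qed.

Lemma W_kappa_bigcup_leaf Pbar : W D Pbar ->
  W_kappa kappa E = \bigcup_(P in leaf_L kappa E Pbar) leaf_J kappa E P.
Proof.
move=> PbW; apply/seteqP; split=> [P PW|_ [P [PW _] [Qbar QW <-]]].
  (* This matrix lumps to [Pbar], and embedding [lump kappa P] along it gives back [P]. *)
  exists (canonical_embedding kappa E P Pbar).
    by split; [exact: embedding_W_kappa|exact: lump_embedding].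
  by exists (lump kappa P); [exact: lump_W|exact: embedding_swap].
exact: embedding_W_kappa.
Qed.

(** Lumping a common element recovers its parameter, so both leaves use the same [A]. Since [P] and
    [Q] both lump to [Pbar], the positive factors [A] and [Pbar] cancel on each edge. *)
Lemma trivIset_leaf_J Pbar : W D Pbar ->
  trivIset (leaf_L kappa E Pbar) (leaf_J kappa E).
Proof.
move=> [_ Pbpos _] P Q [PW lP] [QW lQ] [_ [[A AW <-] [B BW eqAB]]].
have eAB : A = B.
  by rewrite -(lump_embedding PW AW) -eqAB lump_embedding.
move: eqAB; rewrite -{B BW}eAB => eqPQ.
have [[_ _ P0] _] := PW; have [[_ _ Q0] _] := QW; have [_ Apos _] := AW.
apply/ffunP => e; have [eE|eE] := boolP (e \in E); last by rewrite P0 ?Q0.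
have eD := lumped_edge kappa eE.
move/ffunP: eqPQ => /(_ e); rewrite !embeddingE // lP lQ.
by move/(mulfI (lt0r_neq0 (Apos _ eD)))/(divIf (lt0r_neq0 (Pbpos _ eD))).
Qed.

End Lumping.

(** * The linear space of directions of [W_kappa] *)

(** The homogeneous form of the equations satisfied on [W_kappa]: row sums become 0, and positivity,
    an open condition, is left out. *)
Definition tangent (R : realType) (X Y : finType) (kappa : Y -> X)
    (E : {set Y * Y}) (A : {ffun Y * Y -> R}) : Prop :=
  [/\ forall e, e \notin E -> A e = 0,
      forall y, \sum_y' A (y, y') = 0
    & lumpable kappa A].

Section Tangent.
Variables (R : realType) (X Y : finType) (kappa : Y -> X) (E : {set Y * Y}).
Implicit Types P Q A : {ffun Y * Y -> R}.
Local Notation D := (lumped_edges kappa E).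

Lemma tangent_sum (I : finType) (w : I -> R) (A : I -> {ffun Y * Y -> R}) :
  (forall i, tangent kappa E (A i)) ->
  tangent kappa E [ffun e => \sum_i w i * A i e].
Proof.
move=> tA; split=> [e eE|y|].
- by rewrite ffunE big1 // => i _; have [-> //] := tA i; rewrite mulr0.
- under eq_bigr do rewrite ffunE.
  rewrite exchange_big big1 //= => i _; rewrite -mulr_sumr.
  by have [_ -> _] := tA i; rewrite mulr0.
- apply/lumpable_rowE => y1 y2 x' k12.
  under eq_bigr do rewrite ffunE; under [RHS]eq_bigr do rewrite ffunE.
  rewrite exchange_big [RHS]exchange_big /=; apply: eq_bigr => i _.
  rewrite -!mulr_sumr; congr (_ * _).
  by have [_ _ /lumpable_rowE] := tA i; apply.
Qed.

Lemma tangentB A B : tangent kappa E A -> tangent kappa E B ->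
  tangent kappa E [ffun e => A e - B e].
Proof.
move=> tA tB.
have -> : [ffun e => A e - B e] =
    [ffun e => \sum_(b : bool) (-1) ^+ b * (if b then B else A) e].
  by apply/ffunP => e; rewrite !ffunE big_bool /= expr1 expr0 mul1r mulN1r addrC.
by apply: tangent_sum => -[].
Qed.

Lemma W_kappa_tangentE Q P : W_kappa kappa E Q ->
  W_kappa kappa E P <->
  (forall e, e \in E -> 0 < P e) /\ tangent kappa E [ffun e => P e - Q e].
Proof.
move=> [[[_ Q1] _ Q0] /lumpable_rowE Ql].
split=> [[[[_ P1] Ppos P0] /lumpable_rowE Pl]|[Ppos [T0 T1 /lumpable_rowE Tl]]].
  split=> //; split=> [e eE|y|]; first by rewrite ffunE P0 ?Q0 ?subrr.
    by under eq_bigr do rewrite ffunE; rewrite sumrB P1 Q1 subrr.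
  apply/lumpable_rowE => y1 y2 x' k12.
  under eq_bigr do rewrite ffunE; under [RHS]eq_bigr do rewrite ffunE.
  by rewrite !sumrB (Pl _ _ _ k12) (Ql _ _ _ k12).
have P0 e : e \notin E -> P e = 0.
  by move=> eE; have := T0 e eE; rewrite ffunE Q0 // subr0.
split; first split=> //.
  split=> [e|y].
    by have [/Ppos/ltW|/P0->] := boolP (e \in E).
  apply/eqP; rewrite -(Q1 y) -subr_eq0 -sumrB -[X in _ == X](T1 y).
  by apply/eqP/eq_bigr => y' _; rewrite ffunE.
apply/lumpable_rowE => y1 y2 x' k12; have := Tl y1 y2 x' k12.
under eq_bigr do rewrite ffunE; under [RHS]eq_bigr do rewrite ffunE.
by rewrite !sumrB (Ql _ _ _ k12) => /addIr.
Qed.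

(** * Pivots, free edges and a basis of the directions *)

(* [r x] represents the fiber of [x], the sum over the block [q x] is fixed by the
   total row sum, and the entry at [(y, p y x')] is fixed by the sum over the block
   [x']. *)
Variables (r : X -> Y) (q : X -> X) (p : Y -> X -> Y).
Hypothesis rK : forall x, kappa (r x) = x.
Hypothesis qD : forall x, (x, q x) \in D.
Hypothesis pE : forall y x', (kappa y, x') \in D -> (y, p y x') \in E.
Hypothesis pK : forall y x', (kappa y, x') \in D -> kappa (p y x') = x'.

(** The pairs of a state and a block that carry a pivot: every block met by the row of a
    non-representative, and only the block [q x] in the row of [r x]. *)
Definition determined : {set Y * X} :=
  [set a : Y * X | ((kappa a.1, a.2) \in D) &&
                   ((a.1 != r (kappa a.1)) || (a.2 == q (kappa a.1)))].

Definition pivots : {set Y * Y} := [set (a.1, p a.1 a.2) | a in determined].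

Definition free_edges : {set Y * Y} := E :\: pivots.

Lemma mem_pivots y y' : ((y, y') \in pivots) =
  [&& y' == p y (kappa y'), (kappa y, kappa y') \in D
    & (y != r (kappa y)) || (kappa y' == q (kappa y))].
Proof.
apply/imsetP/and3P => [[[z x']]|[/eqP y'E yD yr]].
  by rewrite inE /= => /andP[zD zr] [-> ->]; rewrite pK.
by exists (y, kappa y'); rewrite ?inE /= ?yD -?y'E.
Qed.

(** Three complements are counted: the pivots in [E], the determined pairs among all pairs [K0] over
    [D], and the graph [QX] of [q] in [D]. *)
Lemma card_free_edges :
  #|free_edges|%:Z = #|E|%:Z - \sum_(e in D) #|fiber kappa e.1|%:Z
                     + #|D|%:Z - #|X|%:Z.
Proof.
have cF : (#|free_edges| + #|determined| = #|E|)%N.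
  have <- : #|pivots| = #|determined|.
    apply: card_in_imset => -[y x] [z x']; rewrite !inE /= => /andP[yD _] /andP[zD _].
    by move=> [yz pp]; rewrite yz -(pK yD) pp pK.
  have /finset.setIidPr pI : pivots \subset E.
    apply/fintype.subsetP => _ /imsetP[[y x'] + ->]; rewrite inE /= => /andP[yD _].
    exact: pE.
  by rewrite addnC -(cardsID pivots E) pI.
pose K0 := [set a : Y * X | (kappa a.1, a.2) \in D]%SET.
pose QX := [set (x, q x) | x in [set: X]]%SET.
have cK0 : #|K0| = (\sum_(e in D) #|fiber kappa e.1|)%N.
  rewrite -sum1_card (partition_big (fun a => (kappa a.1, a.2)) (mem D)) /=; last first.
    by move=> a; rewrite inE.
  apply: eq_bigr => -[x x'] xD; rewrite sum1dep_card /=.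
  rewrite -(card_imset (fiber kappa x) (_ : injective (fun y => (y, x')))); last first.
    by move=> y z [].
  apply: eq_card => -[y z]; rewrite !inE /= xpair_eqE.
  apply/and3P/imsetP => [[_ /eqP yx /eqP ->]|[w + [-> ->]]].
    by exists y; rewrite // inE yx.
  by rewrite inE => /eqP ->; rewrite xD.
have cG : (#|D :\: QX| + #|determined| = #|K0|)%N.
  have -> : #|D :\: QX| = #|K0 :\: determined|.
    (* The pairs left undetermined are exactly the [(r x, x')] with [(x, x')] in [D] and [x'] other
       than [q x]. *)
    rewrite -(card_imset (D :\: QX) (_ : injective (fun e => (r e.1, e.2)))); last first.
      by move=> [x x'] [z z'] /= [/(congr1 kappa)]; rewrite !rK => -> ->.
    apply: eq_card => -[y x']; rewrite !inE /=.
    apply/imsetP/andP => [[[z z'] + [-> ->]] /=|].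
      rewrite !inE rK eqxx /= => /andP[zQ zD]; rewrite zD; split=> //=.
      by apply: contra zQ => /eqP ->; apply/imsetP; exists z.
    rewrite negb_and negb_or => -[+ yD]; rewrite yD /= negbK => /andP[/eqP yr x'q].
    exists (kappa y, x'); last by rewrite /= -yr.
    rewrite inE yD andbT; apply: contra x'q => /imsetP[x _ [-> ->]] //.
  have /finset.setIidPr pI : determined \subset K0.
    by apply/fintype.subsetP => a; rewrite !inE => /andP[].
  by rewrite addnC -(cardsID determined K0) pI.
have cQ : (#|D :\: QX| + #|X| = #|D|)%N.
  have <- : #|QX| = #|X|.
    by rewrite -cardsT; apply: card_imset => x z [].
  have /finset.setIidPr pI : QX \subset D.
    by apply/fintype.subsetP => _ /imsetP[x _ ->].
  by rewrite addnC -(cardsID QX D) pI.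
rewrite -(big_morph _ PoszD (erefl _)) -cK0 -cF -cG -cQ !PoszD.
ring.
Qed.

(** In the row of [r x] all blocks but [q x] have only free edges, so their sums vanish; the row sum
    settles [q x], and lumpability carries this to every row. Each pivot is then alone in a block of
    sum 0. *)
Lemma tangent_eq0 A : tangent kappa E A ->
  (forall e, e \in free_edges -> A e = 0) -> forall e, A e = 0.
Proof.
move=> [A0 A1 /lumpable_rowE Al] Afree.
have block_other x x' : x' != q x -> \sum_(y' in fiber kappa x') A (r x, y') = 0.
  move=> x'q; apply: big1 => y'; rewrite inE => /eqP kx'.
  have [yE|/A0//] := boolP ((r x, y') \in E); apply: Afree.
  by rewrite inE yE andbT mem_pivots rK kx' eqxx (negbTE x'q) !andbF.
have block_r x x' : \sum_(y' in fiber kappa x') A (r x, y') = 0.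
  have [->|/block_other//] := eqVneq x' (q x).
  have := A1 (r x); rewrite (sum_fibers kappa) (bigD1 (q x)) //=.
  by rewrite [X in _ + X]big1 ?addr0 // => z; exact: block_other.
have block y x' : \sum_(y' in fiber kappa x') A (y, y') = 0.
  by rewrite (Al y (r (kappa y))) ?rK.
move=> [y y']; have [yF|] := boolP ((y, y') \in free_edges); first exact: Afree.
rewrite inE negb_and negbK => /orP[|/A0//].
rewrite mem_pivots => /and3P[/eqP y'E _ _].
have := block y (kappa y'); rewrite (bigD1 y') ?inE //= big1 ?addr0 // => z.
rewrite inE => /andP[/eqP kz zy']; have [yE|/A0//] := boolP ((y, z) \in E).
by apply: Afree; rewrite inE yE andbT mem_pivots kz -y'E (negbTE zy').
Qed.

(** The prescribed values are extended by 0, then each block is corrected at its position [p] to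
    reach a sum depending only on the fiber. *)
Lemma tangent_extension (a : Y * Y -> R) :
  exists2 A, tangent kappa E A & forall e, e \in free_edges -> A e = a e.
Proof.
pose a0 e := if e \in free_edges then a e else 0.
pose T y x' := \sum_(y' in fiber kappa x') a0 (y, y').
(* The target block sums: those of the representative's row, with the block [q x] shifted so that
   they total 0. *)
pose B x x' := T (r x) x' - (x' == q x)%:R * \sum_z T (r x) z.
pose A : {ffun Y * Y -> R} := [ffun e => a0 e +
  (e.2 == p e.1 (kappa e.2))%:R * (B (kappa e.1) (kappa e.2) - T e.1 (kappa e.2))].
have a0E e : e \notin E -> a0 e = 0.
  by move=> eE; rewrite /a0 inE (negbTE eE) andbF.
have T0 y x' : (kappa y, x') \notin D -> T y x' = 0.
  move=> xD; apply: big1 => y'; rewrite inE => /eqP kx'; apply: a0E.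
  by apply: contra xD => /(lumped_edge kappa) /=; rewrite kx'.
have B0 x x' : (x, x') \notin D -> B x x' = 0.
  move=> xD; rewrite /B T0 ?rK // (_ : (x' == q x) = false) ?mul0r ?subr0 //.
  by apply/negbTE; apply: contra xD => /eqP ->.
have blockA y x' : \sum_(y' in fiber kappa x') A (y, y') = B (kappa y) x'.
  have -> : \sum_(y' in fiber kappa x') A (y, y') = T y x' +
      \sum_(y' in fiber kappa x') (y' == p y x')%:R * (B (kappa y) x' - T y x').
    rewrite -big_split /=; apply: eq_bigr => y'; rewrite inE ffunE => /eqP /= ->.
    by [].
  have [yD|yD] := boolP ((kappa y, x') \in D); last first.
    by rewrite B0 ?T0 // subrr big1 ?addr0 // => z _; rewrite mulr0.
  rewrite [X in _ + X](bigD1 (p y x')) ?inE ?pK //= eqxx mul1r big1 ?addr0 1?addrC ?subrK //.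
  by move=> z /andP[_ /negbTE->]; rewrite mul0r.
exists A; first split=> [[y y'] eE|y|].
- rewrite ffunE a0E //= add0r; have [y'p|] := eqVneq; last by rewrite mul0r.
  have yD : (kappa y, kappa y') \notin D.
    by apply: contra eE => /pE; rewrite -y'p.
  by rewrite B0 ?T0 // subrr mulr0.
- rewrite (sum_fibers kappa); under eq_bigr do rewrite blockA.
  rewrite sumrB -mulr_suml [X in X * _](bigD1 (q (kappa y))) //= eqxx.
  rewrite [X in (_ + X) * _]big1 ?addr0 ?mul1r ?subrr //.
  by move=> z /negbTE->.
- by apply/lumpable_rowE => y1 y2 x' k12; rewrite !blockA k12.
move=> [y y'] eF; rewrite ffunE /a0 eF /=.
(* A free edge at position [p] lies in a representative's row, in a block other than [q]; there [B]
   equals [T] and the correction is 0. *)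
have [y'p|] := eqVneq y' (p y (kappa y')); last by rewrite mul0r addr0.
move: eF; rewrite inE mem_pivots -y'p eqxx /= => /andP[+ eE].
rewrite (lumped_edge kappa eE) /= negb_or negbK => /andP[/eqP yr y'q].
by rewrite /B -yr (negbTE y'q) mul0r subr0 subrr mulr0 addr0.
Qed.

(** Extending the indicator of each free edge gives directions dual to the free entries. Duality
    yields independence; vanishing of a direction without free entries yields spanning. *)
Lemma tangent_basis : exists2 M : 'M[R]_(#|free_edges|, #|{: Y * Y}|),
  row_free M & forall A, (coords A <= M)%MS <-> tangent kappa E A.
Proof.
have /choice[b b_dual] (f : Y * Y) : exists A, tangent kappa E A /\
    forall e, e \in free_edges -> A e = (e == f)%:R.
  by have [A] := tangent_extension (fun e => (e == f)%:R); exists A.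
exists (\matrix_k coords (b (enum_val k))).
  (* The right inverse selects the columns of the free edges. *)
  apply/row_freeP; exists (\matrix_(k, j) (k == enum_rank (enum_val j))%:R).
  apply/matrixP => i j; rewrite !mxE (bigD1 (enum_rank (enum_val j))) //= !mxE.
  rewrite eqxx mulr1 enum_rankK big1 ?addr0 => [|k /negbTE kj]; last first.
    by rewrite !mxE kj mulr0.
  rewrite (b_dual _).2 ?enum_valP // (inj_eq enum_val_inj) eq_sym //.
move=> A; split=> [/submxP[w Aw]|tA].
  have -> : A = [ffun e => \sum_k w 0 k * b (enum_val k) e].
    apply/ffunP => e; move/rowP: Aw => /(_ (enum_rank e)).
    rewrite !mxE enum_rankK ffunE => ->; apply: eq_bigr => k _.
    by rewrite !mxE enum_rankK.
  by apply: tangent_sum => k; exact: (b_dual _).1.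
apply/submxP; exists (\row_k A (enum_val k)).
pose A' := [ffun e => \sum_(k < #|free_edges|) A (enum_val k) * b (enum_val k) e].
have tA' : tangent kappa E A'.
  by apply: tangent_sum => k; exact: (b_dual _).1.
have AA' e : A e = A' e.
  apply/eqP; rewrite -subr_eq0; have := tangent_eq0 (tangentB tA tA').
  move=> /(_ _ e); rewrite ffunE => -> // {}e eF; rewrite !ffunE.
  rewrite (bigD1 (enum_rank_in eF e)) //= enum_rankK_in // (b_dual _).2 // eqxx mulr1.
  rewrite big1 ?addr0 ?subrr // => k ke; rewrite (b_dual _).2 //.
  rewrite (_ : (e == _) = false) ?mulr0 //; apply/negbTE; apply: contra ke => /eqP ek.
  by apply/eqP/enum_val_inj; rewrite enum_rankK_in.
apply/rowP => j; rewrite !mxE AA' ffunE; apply: eq_bigr => k _.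
by rewrite !mxE.
Qed.

End Tangent.

Theorem theorem6p1 (R : realType) (X Y : finType) (E : {set Y * Y}) (kappa : Y -> X)
    (cardX : (1 < #|X|)%N) (cardY : (1 < #|Y|)%N)
    (E_sc : strongly_connected E)
    (kappa_surj : forall x : X, exists y : Y, kappa y = x)
    (Wk_neq0 : @W_kappa R X Y kappa E !=set0)
    (P0 : {ffun X * X -> R}) (P0_W : W (lumped_edges kappa E) P0) :
  (W_kappa kappa E = \bigcup_(P in leaf_L kappa E P0) leaf_J kappa E P
   /\ trivIset (leaf_L kappa E P0) (leaf_J kappa E))
  /\ exists d : nat,
       submanifold_dim (@coords R Y @` W_kappa kappa E) d
       /\ (d%:Z = #|E|%:Z - \sum_(e in lumped_edges kappa E) #|fiber kappa e.1|%:Z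
                  + #|lumped_edges kappa E|%:Z - #|X|%:Z)%R.
Proof.
split; first by split; [exact: W_kappa_bigcup_leaf|exact: trivIset_leaf_J].
have [Q QW] := Wk_neq0; have [[[Q0 Q1] _ Qoff] Ql] := QW.
have QE e : 0 < Q e -> e \in E.
  by apply: contraTT => /Qoff->; rewrite ltxx.
have /choice[r rK] := kappa_surj.
(* A row of [Q] sums to 1, so it has a positive entry, which lies on an edge. *)
have /choice[q qD] (x : X) : exists x', (x, x') \in lumped_edges kappa E.
  have /psumr_neq0P[//|y' /QE /(lumped_edge kappa)] : \sum_y' Q (r x, y') <> 0.
    by rewrite Q1; apply/eqP/oner_neq0.
  by rewrite /= rK; exists (kappa y').
have /choice[p pP] (a : Y * X) : exists z,
    (kappa a.1, a.2) \in lumped_edges kappa E -> (a.1, z) \in E /\ kappa z = a.2.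
  have [aD|aD] := boolP ((kappa a.1, a.2) \in lumped_edges kappa E); last first.
    by exists a.1.
  (* Membership in [D] only gives an edge from some state of the fiber; lumpability of [Q] makes the
     block sum positive from every state, hence an edge from [a.1] itself. *)
  have := lump_gt0 QW aD; rewrite lumpE // => /lt0r_neq0/eqP/psumr_neq0P[//|z].
  by rewrite inE => /andP[/eqP kz /QE zE]; exists z.
pose p' y x' := p (y, x').
have pE y x' : (kappa y, x') \in lumped_edges kappa E -> (y, p' y x') \in E.
  by move=> /(pP (y, x'))[].
have pK y x' : (kappa y, x') \in lumped_edges kappa E -> kappa (p' y x') = x'.
  by move=> /(pP (y, x'))[].
exists #|free_edges kappa E r q p'|; split; last exact: (card_free_edges rK qD pE pK).
have [M Mfree MP] := tangent_basis R rK qD pE pK.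
apply: (affine_submanifold (@open_positive_entries R _ E) Mfree (p0 := coords Q)) => u.
(* [P] is the matrix with coordinate vector [u], so that membership can be tested on matrices. *)
pose P : {ffun Y * Y -> R} := [ffun e => u 0 (enum_rank e)].
have uP : u = coords P by apply/rowP => k; rewrite !mxE ffunE enum_valK.
have -> : u - coords Q = coords [ffun e => P e - Q e].
  by apply/rowP => k; rewrite uP !mxE !ffunE.
split=> [[P' + P'u]|[Uu /MP tP]].
  have -> : P' = P by apply/ffunP => e; rewrite ffunE -P'u mxE enum_rankK.
  move=> /(W_kappa_tangentE _ QW)[Ppos /MP tP]; split=> // e /Ppos.
  by rewrite ffunE.
exists P => //; apply/(W_kappa_tangentE _ QW); split=> // e eE.
by rewrite ffunE; exact: Uu.
Qed.
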